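(* Let $\mathcal{G}^C$ be an admissible cluster-DAG and let $\mathcal{G}^C_{\leq 4}$ be the corresponding cluster-DAG in which all clusters of size greater than $4$ are reduced to size $4$. Let $\mathcal{X}^C,\mathcal{Y}^C,\mathcal{Z}^C$ be pairwise disjoint subsets of nodes. The following propositions are equivalent: 1. There exist $\mathcal{G}^m\in\mathcal{C}(\mathcal{G}^C)$ and a path $\pi^m$ in $\mathcal{G}^m$ from $\mathcal{X}^m$ to $\mathcal{Y}^m$ that is active given $\mathcal{Z}^m$. 2. There exist $\mathcal{G}^m_{\leq 4}\in\mathcal{C}(\mathcal{G}^C_{\leq 4})$ and a path $\pi^m$ in $\mathcal{G}^m_{\leq 4}$ from $\mathcal{X}^m$ to $\mathcal{Y}^m$ that is active given $\mathcal{Z}^m$.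
   Context: A mixed graph is a finite graph with directed edges ($\rightarrow$) and bidirected edges ($\leftrightarrow$); both kinds may be present between the same two vertices. An ADMG is a mixed graph without directed cycles, all of whose edges join distinct vertices. Cluster-DAG: a finite mixed graph $\mathcal{G}^C=(\mathcal{V}^C,(\mathcal{E}^C_D,\mathcal{E}^C_B))$ whose nodes are pairwise disjoint non-empty clusters of variables; a cluster $V$ of size $\#V\ge 1$ is $V=\{V_1,\dots,V_{\#V}\}$. Directed cycles in $\mathcal{G}^C$ and self-loops of both types (directed and bidirected) are allowed. Compatible micro graph: an ADMG $\mathcal{G}^m=(\mathcal{V}^m,(\mathcal{E}^m_D,\mathcal{E}^m_B))$ with $\mathcal{V}^m=\bigcup_{V\in\mathcal{V}^C}\{V_1,\dots,V_{\#V}\}$ such that: for all distinct clusters $A,B$, $A\rightarrow B\in\mathcal{E}^C_D$ iff there are $i,j$ with $A_i\rightarrow B_j\in\mathcal{E}^m_D$; for all distinct clusters $A,B$, $A\leftrightarrow B\in\mathcal{E}^C_B$ iff there are $i,j$ with $A_i\leftrightarrow B_j\in\mathcal{E}^m_B$; for each cluster $A$, the directed self-loop on $A$ is in $\mathcal{E}^C_D$ iff there are distinct $i,j$ with $A_i\rightarrow A_j\in\mathcal{E}^m_D$; for each cluster $A$, the bidirected self-loop on $A$ is in $\mathcal{E}^C_B$ iff there are distinct $i,j$ with $A_i\leftrightarrow A_j\in\mathcal{E}^m_B$. $\mathcal{C}(\mathcal{G}^C)$ is the set of all micro graphs compatible with $\mathcal{G}^C$. $\mathcal{G}^C$ is admissible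 if $\mathcal{C}(\mathcal{G}^C)\ne\emptyset$. $\mathcal{G}^C_{\leq 4}$ has the same nodes and edges as $\mathcal{G}^C$, but each cluster $V$ has size $\min(\#V,4)$. For a set $\mathcal{S}^C$ of clusters, $\mathcal{S}^m$ is the set of all variables belonging to the clusters of $\mathcal{S}^C$ (with cluster sizes those of the cluster-DAG under consideration). A path is a sequence of distinct vertices joined by consecutive edges. An interior vertex is a collider on it if both adjacent path edges have an arrowhead at it; all other vertices are non-colliders. A path is active given $\mathcal{Z}$ if every collider on it is in $\mathcal{Z}$ or has a descendant in $\mathcal{Z}$, and no non-collider on it is in $\mathcal{Z}$. *)

(* Defs.v *)
From HB Require Import structures.
From mathcomp Require Import all_boot.

Set Implicit Arguments.
Unset Strict Implicit.
Unset Printing Implicit Defensive.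

(* Directed and bidirected edges are independent, so both kinds may join the
   same two vertices; self-loops are not excluded at this level. *)
Record mixed_graph (T : finType) := MixedGraph {
  dir : rel T;
  bid : rel T;
  bid_sym : symmetric bid
}.

Definition acyclic (T : finType) (G : mixed_graph T) : Prop :=
  forall c : seq T, cycle (dir G) c -> c = [::].

Definition is_admg (T : finType) (G : mixed_graph T) : Prop :=
  [/\ acyclic G, irreflexive (dir G) & irreflexive (bid G)].

(* The way an edge is traversed by a path, from [x] to [y]:
   [x -> y], [x <- y] or [x <-> y]. *)
Inductive edge_kind := Forward | Backward | Bidirected.

Definition edge (T : finType) (G : mixed_graph T) (k : edge_kind) (x y : T) :
    bool :=
  match k with
  | Forward => dir G x y
  | Backward => dir G y x
  | Bidirected => bid G x y
  end.

Definition head_at_source (k : edge_kind) : bool :=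
  if k is Forward then false else true.

Definition head_at_target (k : edge_kind) : bool :=
  if k is Backward then false else true.

(* A walk is given by its first vertex [x] and the list [p] of its steps, each
   step being the edge taken and the vertex reached. The edges have to be
   recorded, as two vertices may be joined by several edges. *)
Fixpoint is_walk (T : finType) (G : mixed_graph T) (x : T)
    (p : seq (edge_kind * T)) : bool :=
  if p is (k, y) :: p' then edge G k x y && is_walk G y p' else true.

Definition vertices (T : finType) (x : T) (p : seq (edge_kind * T)) : seq T :=
  x :: unzip2 p.

Definition is_path (T : finType) (G : mixed_graph T) (x : T)
    (p : seq (edge_kind * T)) : bool :=
  is_walk G x p && uniq (vertices x p).

Definition is_path_from_to (T : finType) (G : mixed_graph T) (X Y : {set T})
    (x : T) (p : seq (edge_kind * T)) : Prop :=
  [/\ is_path G x p, x \in X & last x (unzip2 p) \in Y].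

(* Only interior vertices qualify: [v] is reached by a step and left by the
   next one. *)
Definition collider_on (T : finType) (p : seq (edge_kind * T)) (v : T) : Prop :=
  exists p1 k1 k2 w p2,
    [/\ p = p1 ++ (k1, v) :: (k2, w) :: p2,
        head_at_target k1 & head_at_source k2].

Definition descendant (T : finType) (G : mixed_graph T) (v z : T) : bool :=
  connect (dir G) v z.

Definition active (T : finType) (G : mixed_graph T) (Z : {set T}) (x : T)
    (p : seq (edge_kind * T)) : Prop :=
  (forall v, collider_on p v ->
     v \in Z \/ exists2 z, z \in Z & descendant G v z) /\
  (forall v, v \in vertices x p -> ~ collider_on p v -> v \notin Z).

(* The clusters are indexed by [N]. *)
Record cluster_dag (N : finType) := ClusterDag {
  cgraph :> mixed_graph N;
  csize : N -> nat;
  csize_gt0 : forall V, 0 < csize V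
}.

(* The variables of all clusters; using a disjoint union makes the clusters
   pairwise disjoint. *)
Definition micro_var (N : finType) (G : cluster_dag N) : finType :=
  {V : N & 'I_(csize G V)}.

Definition mvar (N : finType) (G : cluster_dag N) (V : N) (i : 'I_(csize G V)) :
    micro_var G :=
  Tagged (fun V => 'I_(csize G V)) i.

Definition micro_set (N : finType) (G : cluster_dag N) (S : {set N}) :
    {set micro_var G} :=
  [set v : micro_var G | tag v \in S].

Definition compatible (N : finType) (G : cluster_dag N)
    (Gm : mixed_graph (micro_var G)) : Prop :=
  [/\ is_admg Gm,
      forall A B : N, A != B ->
        (dir G A B <-> exists i j, dir Gm (@mvar N G A i) (@mvar N G B j)),
      forall A B : N, A != B ->
        (bid G A B <-> exists i j, bid Gm (@mvar N G A i) (@mvar N G B j)),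
      forall A : N,
        dir G A A <->
        exists i j, i != j /\ dir Gm (@mvar N G A i) (@mvar N G A j)
    & forall A : N,
        bid G A A <->
        exists i j, i != j /\ bid Gm (@mvar N G A i) (@mvar N G A j)].

Definition admissible (N : finType) (G : cluster_dag N) : Prop :=
  exists Gm : mixed_graph (micro_var G), compatible Gm.

Lemma minn_csize_gt0 (N : finType) (G : cluster_dag N) (V : N) :
  0 < minn (csize G V) 4.
Proof. by rewrite leq_min csize_gt0. Qed.

Definition reduce4 (N : finType) (G : cluster_dag N) : cluster_dag N :=
  ClusterDag (cgraph G) (@minn_csize_gt0 N G).

(* Main.v *)
Require Import Defs.
From mathcomp Require Import all_boot.

Set Implicit Arguments.
Unset Strict Implicit.
Unset Printing Implicit Defensive.

(** An active path in a compatible micro graph depends on little: an order of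
    the variables and the cluster edges. Take a rank [r] that increases along
    the directed edges, and add every edge that the clusters and the rank
    permit ([rank_graph]): [u -> v] when the clusters of [u] and [v] are so
    joined and [r u < r v], and [u <-> v] when [u] and [v] differ and their
    clusters are so joined. Nothing is lost, since more edges mean more
    ancestors of the conditioning set, so that an active path stays active. The
    problem becomes that of choosing a rank ([compatible_path_rankE]). Paths
    may also be replaced by walks, since a shortest active walk between given
    ends is a path ([active_walk_uniq]).

    In a rank graph, variables of the same cluster are interchangeable up to
    their rank: lowering the tail of a directed edge, or raising its head,
    keeps the edge. Let [m C] be the lowest variable of a cluster [C], and
    [t C] the highest one that is an ancestor of the conditioning set. Between
    its first visit [a] and its last visit [b] of [C], an active walk can be
    replaced by one of the following ([segment_reduction]), according to the
    marks at [a] and [b] of the edges that enter and leave this segment: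
    - two arrowheads: the single collider [t C];
    - two tails: the single non-collider [m C];
    - arrowhead at [a], tail at [b]: from [a] the segment either runs forward
      all the way to [b], and [b] alone does, or it shows that [a] is an
      ancestor of the conditioning set, and then so is [t C], which has a child
      of the form [t S]; the detour [t C -> t S <- m C] does;
    - tail at [a], arrowhead at [b]: the mirror image.

    Treating the clusters one after the other creates no new variables other
    than the [m C] and [t C], so that in the end each cluster [C] contributes at
    most [m C], [t C] and one more variable ([walk_reduction]). Adding the
    highest variable of [C], so that all the cluster edges keep a witness,
    gives four variables per cluster, and the rank graph restricted to them is
    a compatible micro graph of the reduced cluster-DAG. Conversely, clusters
    can be enlarged without effect ([rank_connected_enlarge]). *)

(** * Active walks *)

Section ActiveWalks.

Variables (T : finType) (G : mixed_graph T) (Z : {set T}).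
Implicit Types (x y v : T) (p q : seq (edge_kind * T)) (h e : bool).

Definition ancestors : {set T} := [set x | [exists z in Z, descendant G x z]].

Lemma ancestorsP x :
  reflect (exists2 z, z \in Z & descendant G x z) (x \in ancestors).
Proof. by rewrite inE; exact: exists_inP. Qed.

Lemma ancestors_connect x y :
  connect (dir G) x y -> y \in ancestors -> x \in ancestors.
Proof.
move=> xy /ancestorsP[z zZ yz]; apply/ancestorsP; exists z => //.
exact: connect_trans xy yz.
Qed.

Lemma ancestors_child x :
  x \in ancestors -> x \notin Z -> exists2 y, y \in ancestors & dir G x y.
Proof.
move=> /ancestorsP[z zZ /connectP[[|y s] /=]]; first by move=> _ <-; rewrite zZ.
move=> /andP[xy ys] zE _; exists y => //.
by apply/ancestorsP; exists z => //; apply/connectP; exists s.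
Qed.

(** [h] and [e] tell whether the edges before and after the visit of [x] have
    an arrowhead at [x]. *)
Definition open_at h e x := if h && e then x \in ancestors else x \notin Z.

(** The marks [h] and [e] stand for edges that would precede and follow the
    walk; with them, activity of a concatenation is activity of the parts. A
    whole walk has [h = e = false], as its ends are non-colliders. *)
Fixpoint active_walk h x p e : bool :=
  if p is (k, y) :: p' then
    [&& open_at h (head_at_source k) x, edge G k x y
      & active_walk (head_at_target k) y p' e]
  else open_at h e x.

Lemma active_walk_cat h x p k y q e :
  active_walk h x (p ++ (k, y) :: q) e =
  [&& active_walk h x p (head_at_source k), edge G k (last x (unzip2 p)) y
    & active_walk (head_at_target k) y q e].
Proof.
by elim: p h x => [|[k' y'] p IHp] h x //=; rewrite IHp !andbA.
Qed.

Lemma active_walk_source x p e : active_walk false x p e -> x \notin Z.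
Proof. by case: p => [|[k y] p] //= /and3P[]. Qed.

Lemma active_walk_target h x p :
  active_walk h x p false -> last x (unzip2 p) \notin Z.
Proof.
elim: p h x => [|[k y] p IHp] h x /=; first by rewrite /open_at andbF.
by case/and3P=> _ _ /IHp.
Qed.

(** Following the walk forward from an arrowhead: the first edge that is not
    directed forward makes a collider, whose ancestor status is inherited back
    to [x]. If there is none, the whole walk is directed. *)
Lemma headed_source_ancestor x p e :
  active_walk true x p e ->
  x \in ancestors \/ ~~ e /\ connect (dir G) x (last x (unzip2 p)).
Proof.
elim: p x => [|[k y] p IHp] x /=.
  by rewrite /open_at; case: e => /= [-> | _]; [left | right].
case: k => /= /and3P[]; rewrite /open_at /=; [|by left|by left].
move=> _ xy /IHp[yA | [ne yp]].
  by left; apply: ancestors_connect yA; exact: connect1.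
by right; split=> //; apply: connect_trans yp; exact: connect1.
Qed.

Lemma headed_target_ancestor h x p :
  active_walk h x p true ->
  last x (unzip2 p) \in ancestors
  \/ ~~ h /\ connect (dir G) (last x (unzip2 p)) x.
Proof.
elim/last_ind: p => [|p [k y] IHp] /=.
  by rewrite /open_at andbT; case: h => [-> | _]; [left | right].
rewrite -cats1 active_walk_cat /unzip2 map_cat last_cat /= => /and3P[].
case: k => /=; rewrite /open_at /=; [by left| |by left].
move=> /IHp[yA yx _ | [nh px] yp _].
  by left; apply: ancestors_connect yA; exact: connect1.
by right; split=> //; apply: connect_trans px; exact: connect1.
Qed.

(** The reason why a cycle can be cut out of an active walk. Only the case of
    two arrowheads is not immediate: a directed cycle ends at a collider, too. *)
Lemma closed_walk_open h x p e :
  active_walk h x p e -> last x (unzip2 p) = x -> open_at h e x.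
Proof.
case: h; last by move=> /active_walk_source; rewrite /open_at.
case: e; last by move=> /active_walk_target + xE; rewrite xE.
by move=> /headed_source_ancestor[|[]].
Qed.

Lemma active_walk_shortcut h x p q p' e :
  active_walk h x (p ++ q ++ p') e ->
  last x (unzip2 (p ++ q)) = last x (unzip2 p) ->
  active_walk h x (p ++ p') e.
Proof.
elim: p h x => [|[k y] p IHp] h x /=; last first.
  by move=> /and3P[-> -> /IHp]; apply.
case: p' => [|[k y] p']; first by rewrite cats0; exact: closed_walk_open.
by rewrite active_walk_cat => /and3P[xq + yp] qx; rewrite qx /= yp => ->;
  rewrite (closed_walk_open xq qx).
Qed.

Lemma split_visit x p :
  x \in unzip2 p -> exists p1 k p2, p = p1 ++ (k, x) :: p2.
Proof.
elim: p => [|[k y] p IHp] //=; rewrite inE => /orP[/eqP<-|/IHp].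
  by exists [::], k, p.
by case=> [p1 [k' [p2 ->]]]; exists ((k, y) :: p1), k', p2.
Qed.

Lemma repeated_vertex x p :
  ~~ uniq (vertices x p) ->
  exists p1 q p2, [/\ p = p1 ++ q ++ p2, 0 < size q &
    last x (unzip2 (p1 ++ q)) = last x (unzip2 p1)].
Proof.
elim: p x => [|[k y] p IHp] x //=; rewrite negb_and negbK.
case/orP=> [|/IHp[p1 [q [p2 [-> q0 lE]]]]]; last first.
  by exists ((k, y) :: p1), q, p2.
rewrite -[y :: _]/(unzip2 ((k, y) :: p)) => /split_visit[q [k' [p2 ->]]].
exists [::], (rcons q (k', x)), p2; rewrite cat_rcons size_rcons.
by split=> //=; rewrite /unzip2 map_rcons last_rcons.
Qed.

Lemma active_walk_uniq h x p e :
  active_walk h x p e ->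
  exists q, [/\ active_walk h x q e, uniq (vertices x q)
    & last x (unzip2 q) = last x (unzip2 p)].
Proof.
have [n] := ubnP (size p); elim: n p => // n IHn p /ltnSE le_p_n xp.
have [Up | /repeated_vertex[p1 [q [p2 [pE q0 lE]]]]] := boolP (uniq (vertices x p)).
  by exists p.
rewrite pE in xp; have xp' := active_walk_shortcut xp lE.
have [|q' [xq' Uq' q'E]] := IHn _ _ xp'.
  apply: leq_trans le_p_n; rewrite pE !size_cat ltn_add2l -[ltnLHS]add0n.
  by rewrite ltn_add2r.
exists q'; split=> //.
by move: q'E lE; rewrite pE /unzip2 !map_cat !last_cat => -> ->.
Qed.

(** At the end of the walk there is no next edge; [false] makes the last vertex
    a non-collider. *)
Definition first_head p := if p is (k, _) :: _ then head_at_source k else false.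

Lemma collider_on_cons k y p v :
  collider_on ((k, y) :: p) v <->
  v = y /\ head_at_target k && first_head p \/ collider_on p v.
Proof.
split.
  case=> [[|kx p1] [k1 [k2 [w [p2 [pE h1 h2]]]]]].
    by case: pE h1 => -> -> ->; left; rewrite h1 /= h2.
  by case: pE => _ pE; right; exists p1, k1, k2, w, p2.
case=> [[-> /andP[h1]] | [p1 [k1 [k2 [w [p2 [-> h1 h2]]]]]]].
  by case: p => [|[k2 w] p2] //= h2; exists [::], k, k2, w, p2.
by exists ((k, y) :: p1), k1, k2, w, p2.
Qed.

Lemma collider_on_mem p v : collider_on p v -> v \in unzip2 p.
Proof.
case=> [p1 [k1 [k2 [w [p2 [-> _ _]]]]]].
by rewrite /unzip2 map_cat mem_cat inE eqxx orbT.
Qed.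

(** The notion of collider in [collider_on] is attached to a vertex and that of
    [active_walk] to a visit; they agree when no vertex is repeated. *)
Lemma active_walk_pathE h x p :
  uniq (vertices x p) ->
  active_walk h x p false <->
  [/\ is_walk G x p, open_at h (first_head p) x,
      forall v, collider_on p v -> v \in ancestors
    & forall v, v \in unzip2 p -> ~ collider_on p v -> v \notin Z].
Proof.
elim: p h x => [|[k y] p IHp] h x /=.
  move=> _; split=> [xo | [] //]; split=> // v; first by move/collider_on_mem.
case/andP=> _ Uyp; have /andP[yNp _] := Uyp; have yNc : ~ collider_on p y.
  by move/collider_on_mem; rewrite (negPf yNp).
split.
  case/and3P=> -> -> /(IHp _ _ Uyp)[-> yo cA ncZ]; split=> // v.
    case/collider_on_cons=> [[->] | /cA //] kh.
    by move: yo; rewrite /open_at kh.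
  rewrite inE => /orP[/eqP-> ync | vp vnc].
    move: yo; rewrite /open_at; case: ifP => // kh _.
    by case: ync; apply/collider_on_cons; left.
  by apply: ncZ => // vc; apply: vnc; apply/collider_on_cons; right.
case=> /andP[-> yp] -> cA ncZ; apply/(IHp _ _ Uyp); split=> //.
- rewrite /open_at; case: ifP => kh.
    by apply: cA; apply/collider_on_cons; left.
  by apply: ncZ; rewrite ?mem_head // => /collider_on_cons[[_]|//]; rewrite kh.
- by move=> v vc; apply: cA; apply/collider_on_cons; right.
move=> v vp vnc; apply: ncZ; rewrite ?inE ?vp ?orbT //.
by case/collider_on_cons=> [[vE _]|//]; rewrite vE (negPf yNp) in vp.
Qed.

Lemma active_pathE x p :
  uniq (vertices x p) ->
  active_walk false x p false <-> is_walk G x p /\ active G Z x p.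
Proof.
move=> Up; have xNc : ~ collider_on p x.
  by move/collider_on_mem; case/andP: Up => /negPf->.
split.
  case/(active_walk_pathE _ Up)=> xp xo cA ncZ; split=> //; split.
    by move=> v /cA /ancestorsP; right.
  by move=> v; rewrite inE => /orP[/eqP-> //|]; exact: ncZ.
case=> xp [cA ncZ]; apply/(active_walk_pathE _ Up); split=> //.
- by apply: ncZ => //; exact: mem_head.
- move=> v /cA[vZ|/ancestorsP//]; apply/ancestorsP; exists v => //.
  exact: connect0.
by move=> v vp; apply: ncZ; rewrite inE vp orbT.
Qed.

Lemma active_path_walkE (X Y : {set T}) :
  (exists x p, is_path_from_to G X Y x p /\ active G Z x p) <->
  (exists x p, [/\ active_walk false x p false, x \in X
                 & last x (unzip2 p) \in Y]).
Proof.
split=> [[x [p [[/andP[xp Up] xX yY] act]]] | [x [p [xp xX yY]]]].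
  by exists x, p; split=> //; apply/active_pathE.
have [q [/active_pathE xq Uq qE]] := active_walk_uniq xp.
have [wq aq] := xq Uq; exists x, q; split=> //; split=> //; last by rewrite qE.
by rewrite /is_path wq.
Qed.

End ActiveWalks.

Lemma active_walk_map (T T' : finType) (G : mixed_graph T) (G' : mixed_graph T')
    (Z : {set T}) (Z' : {set T'}) (f : T -> T') (D : {set T}) :
  {in D &, forall u v k, edge G k u v -> edge G' k (f u) (f v)} ->
  {in D, forall u, u \in ancestors G Z -> f u \in ancestors G' Z'} ->
  {in D, forall u, u \notin Z -> f u \notin Z'} ->
  forall h x p e, {subset vertices x p <= D} -> active_walk G Z h x p e ->
  active_walk G' Z' h (f x) [seq (s.1, f s.2) | s <- p] e.
Proof.
move=> fE fA fZ; have fo h e : {in D, forall u,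
    open_at G Z h e u -> open_at G' Z' h e (f u)}.
  by move=> u uD; rewrite /open_at; case: ifP => _; [exact: fA | exact: fZ].
move=> h x p e; elim: p h x => [|[k y] p IHp] h x /= pD;
  have xD : x \in D by apply: pD; rewrite inE eqxx.
  exact: fo.
have ypD : {subset vertices y p <= D}.
  by move=> v vp; apply: pD; rewrite inE vp orbT.
have yD : y \in D by apply: ypD; rewrite inE eqxx.
by case/and3P=> xo xy yp; rewrite fo // fE // IHp.
Qed.

(** * Rank graphs *)

Section RankGraph.

Variables (T N : finType) (cl : T -> N) (H : mixed_graph N) (r : T -> nat).

Definition rank_dir : rel T := fun u v => dir H (cl u) (cl v) && (r u < r v).

Definition rank_bid : rel T := fun u v => (u != v) && bid H (cl u) (cl v).

Lemma rank_bid_sym : symmetric rank_bid.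
Proof. by move=> u v; rewrite /rank_bid eq_sym bid_sym. Qed.

Definition rank_graph := MixedGraph rank_dir rank_bid_sym.

Lemma rank_graph_admg : is_admg rank_graph.
Proof.
split.
- case=> // x c /= xc.
  have: path (relpre r ltn) x (rcons c x) by apply: sub_path xc => u v /andP[].
  rewrite -path_map => /(order_path_min ltn_trans)/allP/(_ (r x)).
  by rewrite map_rcons mem_rcons mem_head /= ltnn => /(_ isT).
- by move=> x /=; rewrite /rank_dir ltnn andbF.
by move=> x /=; rewrite /rank_bid eqxx.
Qed.

Lemma rank_connect u v : connect (dir rank_graph) u v -> r u <= r v.
Proof.
case/connectP=> s us ->; elim: s u us => //= w s IHs u /andP[/andP[_ uw] ws].
exact: leq_trans (ltnW uw) (IHs _ ws).
Qed.

(** An arrowhead may be moved up within its cluster, and a tail down. For a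
    bidirected edge the rank does not matter, but the two ends must stay
    distinct, which follows from their clusters being distinct. *)
Lemma edge_change_target k u a c :
  edge rank_graph k u a -> cl c = cl a -> cl u != cl a ->
  (if head_at_target k then r a <= r c else r c <= r a) ->
  edge rank_graph k u c.
Proof.
have neq : cl c = cl a -> cl u != cl a -> u != c.
  by move=> <-; apply: contraNneq => ->.
case: k => /= [/andP[Hua lua] cE _ le|/andP[Hua lua] cE _ le|].
- by rewrite /rank_dir cE Hua (leq_trans lua le).
- by rewrite /rank_dir cE Hua (leq_ltn_trans le lua).
by move=> /andP[_ Hua] cE nua _; rewrite /rank_bid neq // cE.
Qed.

Lemma edge_change_source k a c w :
  edge rank_graph k a w -> cl c = cl a -> cl w != cl a ->
  (if head_at_source k then r a <= r c else r c <= r a) ->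
  edge rank_graph k c w.
Proof.
case: k => /=.
- exact: (@edge_change_target Backward).
- exact: (@edge_change_target Forward).
rewrite rank_bid_sym [rank_bid c w]rank_bid_sym.
exact: (@edge_change_target Bidirected).
Qed.

(** * Few variables per cluster *)

Variable ZC : {set N}.

Let Z : {set T} := [set v | cl v \in ZC].
Let A := ancestors rank_graph Z.

Variables m t : N -> T.
Hypotheses (cl_m : cancel m cl) (cl_t : cancel t cl).
Hypothesis m_min : forall v, r (m (cl v)) <= r v.
Hypothesis t_max :
  forall v, v \in A -> t (cl v) \in A /\ r v <= r (t (cl v)).

Definition canonical v := (v == m (cl v)) || (v == t (cl v)).

Lemma canonical_m C : canonical (m C). Proof. by rewrite /canonical cl_m eqxx. Qed.

Lemma canonical_t C : canonical (t C).
Proof. by rewrite /canonical cl_t eqxx orbT. Qed.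

(** A child [s] of [v] that is an ancestor of [Z] can be raised to the top of
    its own cluster. A child of [t (cl v)] serves all that lie below it. *)
Lemma top_child v : v \in A -> cl v \notin ZC ->
  exists S, [/\ t S \in A, rank_dir v (t S), rank_dir (t (cl v)) (t S)
               & rank_dir (m (cl v)) (t S)].
Proof.
move=> vA vZ; have child u : u \in A -> cl u = cl v ->
    exists S, t S \in A /\ dir rank_graph u (t S).
  move=> uA uE; have [|s sA] := ancestors_child uA; first by rewrite inE uE.
  have [tA le] := t_max sA; case/andP=> Hus us; exists (cl s); split=> //=.
  by rewrite /rank_dir cl_t Hus (leq_trans us).
have [tA vt] := t_max vA; have [S [SA /= /andP[HtS tS]]] := child _ tA (cl_t _).
exists S; split=> //; rewrite /= /rank_dir ?cl_m ?cl_t in HtS *.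
- by rewrite HtS (leq_ltn_trans vt).
- by rewrite HtS.
by rewrite HtS (leq_ltn_trans (m_min v)) // (leq_ltn_trans vt).
Qed.

(** The two conditions on ranks are exactly what allows the edges at both ends
    of the segment to be moved to the new ends. *)
Lemma segment_reduction h a q e :
  active_walk rank_graph Z h a q e -> cl (last a (unzip2 q)) = cl a ->
  exists c q' P,
    [/\ active_walk rank_graph Z h c q' e,
        cl c = cl a /\ cl (last c (unzip2 q')) = cl a,
        if h then r a <= r c else r c <= r a,
        if e then r (last a (unzip2 q)) <= r (last c (unzip2 q'))
        else r (last c (unzip2 q')) <= r (last a (unzip2 q))
      & forall v, v \in vertices c q' -> canonical v \/ v = P /\ cl v = cl a].
Proof.
set b := last a _ => aq bE; have mb : r (m (cl a)) <= r b by rewrite -bE.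
set goal := (ex _); have single c : open_at rank_graph Z h e c -> cl c = cl a ->
    (if h then r a <= r c else r c <= r a) ->
    (if e then r b <= r c else r c <= r b) -> goal.
  move=> co cE ha eb; exists c, [::], c; split=> //= v.
  by rewrite inE => /eqP->; right.
rewrite {}/goal in single *.
case: h aq single => aq single; case: e aq single => aq single.
(* Two arrowheads: the top of the cluster, as a collider. *)
- have [aA|[]//] := headed_source_ancestor aq.
  have [bA|[]//] := headed_target_ancestor aq.
  have [tA ta] := t_max aA; have [_] := t_max bA; rewrite bE => tb.
  by apply: (single (t (cl a))).
(* Arrowhead at [a], tail at [b]: go down from the top to the bottom through
   a common child, which is a collider, unless [a] reaches [b]. *)
- have bZ := active_walk_target aq; have [aA|[_ ab]] := headed_source_ancestor aq.
    have aZ : cl a \notin ZC by move: bZ; rewrite inE bE.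
    have [S [SA _ tS mS]] := top_child aA aZ; have [tA ta] := t_max aA.
    exists (t (cl a)), [:: (Forward, t S); (Backward, m (cl a))], a.
    split=> //=; first by rewrite /open_at /= tS mS SA !inE cl_m cl_t aZ.
    by move=> v; rewrite !inE => /or3P[] /eqP->; left;
       rewrite ?canonical_t ?canonical_m.
  apply: (single b) => //; exact: rank_connect ab.
- have aZ := active_walk_source aq; have [bA|[_ ba]] := headed_target_ancestor aq.
    have bZ : cl b \notin ZC by move: aZ; rewrite inE bE.
    have [S [SA _ tS mS]] := top_child bA bZ; have [tA tb] := t_max bA.
    rewrite bE in bZ tS mS tA tb.
    exists (m (cl a)), [:: (Forward, t S); (Backward, t (cl a))], a.
    split=> //=; first by rewrite /open_at /= tS mS SA !inE cl_m cl_t bZ.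
    by move=> v; rewrite !inE => /or3P[] /eqP->; left;
       rewrite ?canonical_t ?canonical_m.
  apply: (single a) => //; exact: rank_connect ba.
(* Two tails: the bottom of the cluster, as a non-collider. *)
apply: (single (m (cl a))) => //.
by have := active_walk_source aq; rewrite /open_at !inE cl_m.
Qed.

Lemma split_last_visit C x (p : seq (edge_kind * T)) :
  cl x = C -> exists q p', [/\ p = q ++ p', cl (last x (unzip2 q)) = C
                             & forall v, v \in unzip2 p' -> cl v != C].
Proof.
move=> xC; elim/last_ind: p => [|p [k y] [q [p' [pE qC p'C]]]].
  by exists [::], [::].
have [yC | yC] := eqVneq (cl y) C.
  exists (rcons p (k, y)), [::]; split=> //; first by rewrite cats0.
  by rewrite /unzip2 map_rcons last_rcons.
exists q, (rcons p' (k, y)); split=> //; first by rewrite pE rcons_cat.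
by move=> v; rewrite /unzip2 map_rcons mem_rcons inE => /orP[/eqP->//|/p'C].
Qed.

(** The induction looks for the first visit of [C], where the rest of the walk,
    up to the last visit, is rebuilt. The source may then change when it is
    in [C]; the rank condition allows the preceding edge to follow. *)
Lemma cluster_reduction C h x p :
  active_walk rank_graph Z h x p false ->
  exists c p' P,
    [/\ active_walk rank_graph Z h c p' false,
        cl (last c (unzip2 p')) = cl (last x (unzip2 p)),
        if cl x == C then
          cl c = C /\ (if h then r x <= r c else r c <= r x)
        else c = x
      & forall v, v \in vertices c p' ->
          [\/ canonical v, v = P /\ cl v = C
            | cl v != C /\ v \in vertices x p]].
Proof.
elim: p h x => [|[k y] p IHp] h x; have [xC|xC] := eqVneq (cl x) C.
- move=> xo; exists x, [::], x; split=> //; first by split=> //; case: (h).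
  by move=> v; rewrite inE => /eqP->; apply: Or32.
- move=> xo; exists x, [::], x; split=> // v; rewrite inE => /eqP->.
  by apply: Or33; split=> //; exact: mem_head.
- move: (_ :: p) => {IHp}p xp.
  have [q [p' [pE qC p'C]]] := split_last_visit p xC.
  have p'x v : v \in unzip2 p' -> v \in vertices x p.
    by move=> vp'; rewrite inE pE /unzip2 map_cat mem_cat vp' !orbT.
  case: p' => [|[k' w] p'] in pE p'C p'x *.
    rewrite cats0 in pE; subst q; have [|c [q' [P [cq [cE lE] hc _ ver]]]] :=
      segment_reduction xp; first by rewrite qC.
    exists c, q', P; rewrite lE cE -xC qC in ver *; split=> // v /ver.
    by case=> [cv|vP]; [apply: Or31 | apply: Or32].
  move: xp; rewrite {1}pE active_walk_cat => /and3P[xq qw wp].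
  have [|c [q' [P [cq [cE lE] hc ec ver]]]] := segment_reduction xq.
    by rewrite qC.
  have wC : cl w != C by apply: p'C; exact: mem_head.
  exists c, (q' ++ (k', w) :: p'), P; split=> //.
  + rewrite active_walk_cat cq wp andbT.
    by apply: edge_change_source qw _ _ ec; rewrite qC // lE.
  + by rewrite pE /unzip2 !map_cat !last_cat.
  + by rewrite cE.
  move=> v; rewrite /vertices /unzip2 map_cat -cat_cons mem_cat => /orP[/ver|vp].
    by rewrite -xC; case=> [cv|vP]; [apply: Or31 | apply: Or32].
  by apply: Or33; split; [exact: p'C | exact: p'x].
move=> /= /and3P[xo xy /IHp[c [p' [P [cp lE cE ver]]]]].
exists x, ((k, c) :: p'), P; split=> //=.
- rewrite xo cp andbT /=; move: cE; case: eqP => [yC [cC kc] | _ -> //].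
  by apply: edge_change_target xy _ _ kc; rewrite yC.
move=> v; rewrite inE => /orP[/eqP->|/ver[cv|vP|[vC vyp]]].
- by apply: Or33; split=> //; exact: mem_head.
- exact: Or31.
- exact: Or32.
by apply: Or33; split=> //; rewrite inE vyp orbT.
Qed.

(** The clusters are treated one by one: treating [C] brings into the other
    clusters only canonical variables, so those already treated stay so. *)
Lemma walk_reduction x p :
  active_walk rank_graph Z false x p false ->
  exists y q (P : N -> T),
    [/\ active_walk rank_graph Z false y q false, cl y = cl x,
        cl (last y (unzip2 q)) = cl (last x (unzip2 p))
      & forall v, v \in vertices y q -> canonical v \/ v = P (cl v)].
Proof.
move=> xp; suff /(_ (enum N))[y [q [P [yq yE lE ver]]]] : forall s : seq N,
    exists y q (P : N -> T), [/\ active_walk rank_graph Z false y q false,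
      cl y = cl x, cl (last y (unzip2 q)) = cl (last x (unzip2 p))
    & forall v, v \in vertices y q ->
        [\/ canonical v, v = P (cl v) | cl v \notin s]].
  exists y, q, P; split=> // v /ver[]; [by left | by right |].
  by rewrite mem_enum.
elim=> [|C s [y [q [P [yq yE lE ver]]]]].
  by exists x, p, (fun=> x); split=> // v _; apply: Or33.
have [c [q' [P' [cq lE' cE ver']]]] := cluster_reduction C yq.
exists c, q', (fun B => if B == C then P' else P B); split=> //.
- by move: cE; case: eqP => [yC [cC _] | _ -> //]; rewrite cC -yC.
- by rewrite lE'.
move=> v /ver'[cv|[vP ->]|[vC /ver[cv|vP|vs]]].
- exact: Or31.
- by apply: Or32; rewrite eqxx.
- exact: Or31.
- by apply: Or32; rewrite (negPf vC).
by apply: Or33; rewrite inE negb_or vC.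
Qed.

End RankGraph.

(** The number of ancestors is a rank. *)
Lemma acyclic_rank (T : finType) (G : mixed_graph T) : acyclic G ->
  exists r : T -> nat, forall u v, dir G u v -> r u < r v.
Proof.
move=> acG; exists (fun v => #|[set u | connect (dir G) u v]|) => u v uv.
apply: proper_card; apply/properP; split.
  by apply/subsetP=> w; rewrite !inE => /connect_trans; apply; exact: connect1.
exists v; rewrite inE ?connect0 //; apply/connectP=> -[s vs uE].
by have := acG (v :: s); rewrite /= rcons_path vs -uE => /(_ uv).
Qed.

(** * Compatible micro graphs and ranks *)

Section ClusterDags.

Variable N : finType.
Implicit Types (G : cluster_dag N) (X Y ZC : {set N}).

(** As micro graphs have no self-loops, the self-loops of clusters obey the same
    rule as the other cluster edges. *)
Lemma compatible_edges G (Gm : mixed_graph (micro_var G)) :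
  compatible Gm <->
  [/\ is_admg Gm,
      forall A B, dir G A B <-> exists u v, [/\ tag u = A, tag v = B & dir Gm u v]
    & forall A B, bid G A B <-> exists u v, [/\ tag u = A, tag v = B & bid Gm u v]].
Proof.
have E (e : rel (micro_var G)) A B :
    (exists u v, [/\ tag u = A, tag v = B & e u v]) <->
    (exists i j, e (@mvar N G A i) (@mvar N G B j)).
  split=> [[[A' i] [[B' j] [/= <- <- eij]]] | [i [j eij]]].
    by exists i, j.
  by exists (mvar i), (mvar j).
have E' (e : rel (micro_var G)) A : irreflexive e ->
    (exists u v, [/\ tag u = A, tag v = A & e u v]) <->
    (exists i j, i != j /\ e (@mvar N G A i) (@mvar N G A j)).
  move=> irr; split=> [/E[i [j eij]] | [i [j [_ eij]]]]; last first.
    by apply/E; exists i, j.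
  by exists i, j; split=> //; apply: contraTneq eij => ->; rewrite irr.
split=> [[admg d b ds bs] | [admg d b]]; have [_ di bi] := admg; split=> //.
- move=> A B; have [<-|AB] := eqVneq A B.
    exact: iff_trans (ds A) (iff_sym (E' _ _ di)).
  exact: iff_trans (d A B AB) (iff_sym (E _ _ _)).
- move=> A B; have [<-|AB] := eqVneq A B.
    exact: iff_trans (bs A) (iff_sym (E' _ _ bi)).
  exact: iff_trans (b A B AB) (iff_sym (E _ _ _)).
- by move=> A B _; exact: iff_trans (d A B) (E _ _ _).
- by move=> A B _; exact: iff_trans (b A B) (E _ _ _).
- by move=> A; exact: iff_trans (d A A) (E' _ _ di).
by move=> A; exact: iff_trans (b A A) (E' _ _ bi).
Qed.

(** What a rank must satisfy for its rank graph to be compatible. Bidirected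
    edges do not depend on the rank, so they only need a cluster to have two
    variables when it has a bidirected self-loop. *)
Definition realizes G (r : micro_var G -> nat) :=
  (forall A B, dir G A B -> exists u v, [/\ tag u = A, tag v = B & r u < r v]) /\
  (forall A, bid G A A -> 1 < csize G A).

Lemma card_cluster G A : #|[set v : micro_var G | tag v == A]| = csize G A.
Proof.
have -> : [set v : micro_var G | tag v == A] = [set @mvar N G A i | i in 'I__].
  apply/setP=> v; rewrite inE; apply/eqP/imsetP => [<-|[i _ ->] //].
  by exists (tagged v) => //; case: v.
rewrite card_imset ?card_ord // => i j /eqP; rewrite eq_Tagged => /eqP.
exact.
Qed.

Lemma cluster_inhabited G A : exists v : micro_var G, tag v = A.
Proof. by exists (mvar (Ordinal (csize_gt0 G A))). Qed.

Lemma rank_graph_compatible G (r : micro_var G -> nat) :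
  realizes r -> compatible (rank_graph (tag : micro_var G -> N) G r).
Proof.
case=> rd rb; apply/compatible_edges; split; first exact: rank_graph_admg.
  move=> A B; split=> [dAB | [u [v [<- <- /andP[]]]] //].
  have [u [v [uA vB uv]]] := rd A B dAB; exists u, v; split=> //=.
  by rewrite /rank_dir uA vB dAB.
move=> A B; split=> [bAB | [u [v [<- <- /andP[]]]] //].
have [E | AB] := eqVneq A B; last first.
  have [[u uA] [v vB]] := (cluster_inhabited G A, cluster_inhabited G B).
  exists u, v; split=> //=; rewrite /rank_bid uA vB bAB andbT.
  by apply: contra_neq AB => uv; rewrite -uA uv.
rewrite -{B}E in bAB *; have := rb A bAB; rewrite -card_cluster.
case/card_gt1P=> u [v []]; rewrite !inE => /eqP uA /eqP vA uv.
by exists u, v; split=> //=; rewrite /rank_bid uv uA vA.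
Qed.

Definition rank_connected G X Y ZC :=
  exists r x p,
    [/\ realizes r,
        active_walk (rank_graph (tag : micro_var G -> N) G r) (micro_set G ZC)
          false x p false,
        tag x \in X & tag (last x (unzip2 p)) \in Y].

Lemma compatible_path_rankE G X Y ZC :
  (exists Gm : mixed_graph (micro_var G), compatible Gm /\
     exists x p,
       is_path_from_to Gm (micro_set G X) (micro_set G Y) x p /\
       active Gm (micro_set G ZC) x p)
  <-> rank_connected G X Y ZC.
Proof.
split=> [[Gm [cGm]] | [r [x [p [rr xp xX yY]]]]]; last first.
  exists (rank_graph tag G r); split; first exact: rank_graph_compatible.
  by apply/active_path_walkE; exists x, p; rewrite !inE.
have [[acyc irrd irrb] Gd Gb] := (compatible_edges Gm).1 cGm.
have [r rP] := acyclic_rank acyc.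
move=> /active_path_walkE[x [p [xp]]]; rewrite !inE => xX yY.
have subd u v : dir Gm u v -> rank_dir tag G r u v.
  by move=> uv; rewrite /rank_dir rP // andbT; apply/Gd; exists u, v.
exists r, x, p; split=> //.
  split=> [A B /Gd[u [v [uA vB uv]]] | A /Gb[u [v [uA vA uv]]]].
    by exists u, v; split=> //; exact: rP.
  rewrite -card_cluster; apply/card_gt1P; exists u, v; rewrite !inE uA vA.
  by split=> //; apply: contraTneq uv => ->; rewrite irrb.
have -> : p = [seq (s.1, id s.2) | s <- p] by elim: (p) => //= -[k y] q /= <-.
apply: (active_walk_map (D := setT) (f := id) _ _ _ _ xp) => //.
- move=> u v _ _ [] /=; [exact: subd | exact: subd |].
  move=> uv; rewrite /rank_bid; apply/andP; split; last by apply/Gb; exists u, v.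
  by apply: contraTneq uv => ->; rewrite irrb.
- move=> u _ /ancestorsP[z zZ uz]; apply/ancestorsP; exists z => //.
  by apply: connect_sub uz => a b ab; apply: connect1; exact: subd.
by move=> u _; rewrite inE.
Qed.

(** A set [D] of variables that carries the walk, a witness of each directed
    cluster edge, and a way from each of its ancestors of [Z] up to [Z], can be
    placed in any clusters large enough to hold it. *)
Lemma rank_connected_transfer G1 G2 X Y ZC (r : micro_var G1 -> nat)
    (D : {set micro_var G1}) x p :
  let GD := rank_graph (tag : micro_var G1 -> N) G1 r in
  let Z := micro_set G1 ZC in
  dir G1 =2 dir G2 -> bid G1 =2 bid G2 ->
  (forall C, #|[set v in D | tag v == C]| <= csize G2 C) ->
  (forall A B, dir G1 A B ->
     exists u v, [/\ u \in D, v \in D, tag u = A, tag v = B & r u < r v]) ->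
  (forall A, bid G1 A A -> 1 < csize G2 A) ->
  (forall v, v \in D -> v \in ancestors GD Z -> v \notin Z ->
     exists s, [/\ s \in D, s \in ancestors GD Z & dir GD v s]) ->
  {subset vertices x p <= D} -> active_walk GD Z false x p false ->
  tag x \in X -> tag (last x (unzip2 p)) \in Y -> rank_connected G2 X Y ZC.
Proof.
move=> GD Z Ed Eb cardD dD bG2 upD pD xp xX yY.
(* The variables of [D] in [C] become the first ones of the new cluster [C];
   those left over get rank 0, but any rank would do, since the edges that it
   creates do no harm. *)
pose s C := enum [set v in D | tag v == C].
have s_lt v : v \in D -> index v (s (tag v)) < csize G2 (tag v).
  move=> vD; apply: leq_trans (cardD _); rewrite cardE index_mem.
  by rewrite mem_enum !inE vD eqxx.
pose g (v : micro_var G1) : micro_var G2 :=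
  mvar (insubd (Ordinal (csize_gt0 G2 (tag v))) (index v (s (tag v)))).
pose r2 (w : micro_var G2) := nth 0 [seq r v | v <- s (tag w)] (tagged w).
have gval v : v \in D -> tagged (g v) = index v (s (tag v)) :> nat.
  by move=> vD; rewrite /= val_insubd s_lt.
have s_mem v : v \in D -> v \in s (tag v).
  by move=> vD; rewrite mem_enum !inE vD eqxx.
have rg v : v \in D -> r2 (g v) = r v.
  move=> vD; rewrite /r2 gval // (nth_map v) ?nth_index ?index_mem //; exact: s_mem.
have ginj : {in D &, injective g}.
  move=> u v uD vD guv; have tuv : tag u = tag v by have := congr1 tag guv.
  have := congr1 (fun w : micro_var G2 => nat_of_ord (tagged w)) guv.
  rewrite !gval // tuv => /(index_inj u).
  by apply; [rewrite -tuv|]; exact: s_mem.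
pose G2r := rank_graph (tag : micro_var G2 -> N) G2 r2.
have dg u v : u \in D -> v \in D -> dir GD u v -> dir G2r (g u) (g v).
  by move=> uD vD; rewrite /= /rank_dir !rg // Ed.
exists r2, (g x), [seq (a.1, g a.2) | a <- p]; split=> //.
- split=> [A B|A]; last by rewrite -Eb; exact: bG2.
  rewrite -Ed => /dD[u [v [uD vD <- <- uv]]]; exists (g u), (g v).
  by split=> //; rewrite !rg.
- apply: (active_walk_map (D := D) _ _ _ _ xp) => //.
  + move=> u v uD vD [] /=; [exact: dg | exact: dg |].
    move=> /andP[nuv buv]; rewrite /rank_bid /= -Eb buv andbT.
    by apply: contra_neq nuv; exact: ginj.
  + move=> u; have [k] := ubnP (\max_v r v - r u); elim: k u => // k IHk u lt_k.
    move=> uD uA; have [uZ | uZ] := boolP (u \in Z).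
      by apply/ancestorsP; exists (g u); rewrite ?inE //= in uZ *; exact: connect0.
    have [v [vD vA uv]] := upD u uD uA uZ.
    apply: (@ancestors_connect _ _ _ _ (g v)); first exact/connect1/dg.
    have /andP[_ ruv] := uv; apply: IHk => //.
    apply: leq_trans (ltn_sub2l _ ruv) (ltnSE lt_k); apply: leq_trans ruv _.
    exact: leq_bigmax.
  + by move=> u _; rewrite !inE.
have -> : unzip2 [seq (a.1, g a.2) | a <- p] = map g (unzip2 p).
  by rewrite /unzip2 -!map_comp.
by rewrite last_map.
Qed.

Lemma cluster_bottom G (r : micro_var G -> nat) :
  exists m : N -> micro_var G, cancel m tag /\ forall v, r (m (tag v)) <= r v.
Proof.
have /fin_all_exists[m mP] C : exists u : micro_var G,
    tag u = C /\ forall v, tag v = C -> r u <= r v.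
  have [w /eqP wC] := cluster_inhabited G C.
  have [u /eqP uC umin] := @arg_minnP _ w [pred u | tag u == C] r wC.
  by exists u; split=> // v /eqP; exact: umin.
by exists m; split=> [C | v]; [case: (mP C) | case: (mP (tag v)) => _; apply].
Qed.

(** In a cluster that does not meet [A], [t] takes an arbitrary value, so that it
    is total and still a section of [tag]. *)
Lemma cluster_top G (r : micro_var G -> nat) (A : {set micro_var G}) :
  exists t : N -> micro_var G, cancel t tag /\
    forall v, v \in A -> t (tag v) \in A /\ r v <= r (t (tag v)).
Proof.
have /fin_all_exists[t tP] C : exists u : micro_var G, tag u = C /\
    forall v, v \in A -> tag v = C -> u \in A /\ r v <= r u.
  have [w /andP[wC wA] | none] :=
      pickP [pred v : micro_var G | (tag v == C) && (v \in A)]; last first.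
    have [w wC] := cluster_inhabited G C; exists w; split=> // v vA vC.
    by have := none v; rewrite /= vC eqxx vA.
  have wP : [pred v : micro_var G | (tag v == C) && (v \in A)] w by rewrite /= wC.
  have [u /andP[/eqP uC uA] umax] := arg_maxnP r wP; exists u; split=> // v vA vC.
  by split=> //; apply: umax; rewrite /= vC eqxx.
exists t; split=> [C | v vA]; first by case: (tP C).
by case: (tP (tag v)) => _; apply.
Qed.

Lemma rank_connected_enlarge G1 G2 X Y ZC :
  dir G1 =2 dir G2 -> bid G1 =2 bid G2 ->
  (forall C, csize G1 C <= csize G2 C) ->
  rank_connected G1 X Y ZC -> rank_connected G2 X Y ZC.
Proof.
move=> Ed Eb le [r [x [p [[rd rb] xp xX yY]]]].
apply: (rank_connected_transfer (D := setT) _ _ _ _ _ _ _ xp) => //.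
- move=> C; apply: leq_trans (le C); rewrite -card_cluster.
  by apply/subset_leq_card/subsetP=> v; rewrite !inE.
- by move=> A B /rd[u [v [uA vB uv]]]; exists u, v.
- by move=> A /rb /leq_trans; exact.
- by move=> v _ vA /(ancestors_child vA)[s sA vs]; exists s.
by move=> v _; rewrite inE.
Qed.

Lemma rank_connected_reduce G1 G2 X Y ZC :
  dir G1 =2 dir G2 -> bid G1 =2 bid G2 ->
  (forall C, minn (csize G1 C) 4 <= csize G2 C) ->
  rank_connected G1 X Y ZC -> rank_connected G2 X Y ZC.
Proof.
move=> Ed Eb le [r [x [p [[rd rb] xp xX yY]]]].
have [m [cl_m m_min]] := cluster_bottom r.
(* [m C] and [M C] together witness every directed cluster edge at [C]. *)
have [M [cl_M M_max]] := cluster_top r setT.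
have [t [cl_t t_max]] :=
  cluster_top r (ancestors (rank_graph tag G1 r) (micro_set G1 ZC)).
have [y [q [P [yq yE qE ver]]]] :=
  walk_reduction cl_m cl_t m_min t_max xp.
pose sel C := [:: m C; t C; M C; P C].
pose D := [set v | v \in sel (tag v)].
apply: (rank_connected_transfer (D := D) _ _ _ _ _ _ _ yq) => //.
- move=> C; apply: leq_trans (le C); rewrite leq_min -{1}card_cluster.
  apply/andP; split.
    by apply/subset_leq_card/subsetP=> v; rewrite !inE => /andP[].
  apply: (leq_trans _ (card_size (sel C))); apply/subset_leq_card/subsetP=> v.
  by rewrite inE => /andP[+ /eqP vC]; rewrite inE vC.
- move=> A B dAB; have [u [v [uA vB uv]]] := rd A B dAB.
  exists (m A), (M B); split; rewrite ?inE ?cl_m ?cl_M ?eqxx ?orbT //.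
  rewrite -uA -vB; apply: leq_ltn_trans (m_min u) (leq_trans uv _).
  by have [] := M_max v (in_setT v).
- by move=> A /rb lt1; apply: leq_trans (le A); rewrite leq_min lt1.
- move=> v _ vA vZ; have [|S [SA vS _ _]] := top_child cl_m cl_t m_min t_max vA.
    by move: vZ; rewrite inE.
  by exists (t S); split=> //; rewrite !inE cl_t eqxx orbT.
- move=> v /ver[/orP[/eqP vE|/eqP vE]|vE]; rewrite inE; move: vE;
  by rewrite !inE => /eqP->; rewrite ?orbT.
- by rewrite yE.
by rewrite qE.
Qed.

End ClusterDags.

Theorem theorem2 (N : finType) (G : cluster_dag N) (hG : admissible G)
    (X Y Z : {set N})
    (hXY : [disjoint X & Y]) (hXZ : [disjoint X & Z]) (hYZ : [disjoint Y & Z]) :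
  (exists Gm : mixed_graph (micro_var G), compatible Gm /\
     exists x p,
       is_path_from_to Gm (micro_set G X) (micro_set G Y) x p /\
       active Gm (micro_set G Z) x p)
  <->
  (exists Gm : mixed_graph (micro_var (reduce4 G)), compatible Gm /\
     exists x p,
       is_path_from_to Gm (micro_set (reduce4 G) X) (micro_set (reduce4 G) Y) x p /\
       active Gm (micro_set (reduce4 G) Z) x p).
Proof.
apply: (iff_trans (compatible_path_rankE _ _ _ _)).
apply: iff_trans (iff_sym (compatible_path_rankE _ _ _ _)).
split; first exact: rank_connected_reduce.
by apply: rank_connected_enlarge => // C; exact: geq_minl.
Qed.
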